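(* Let $p$ be a prime, $r\ge 1$ an integer, $R=\mathbb{Z}/p^r\mathbb{Z}$, and let $A\in R^{2\times 2}$ be a fixed matrix. For every $u\in R$ and every integer $n\ge 5$, $$\pi_{u,n}=\sum_{x\in R^\times}\bigl(\pi_{x,n-1}\,\xi_{x,u}+\pi_{x,n-2}\,\zeta_{x,u}\bigr).$$
   Context: For $a\in R$ put $\eta(a):=\begin{pmatrix} a & -1\\ 1 & 0\end{pmatrix}$. For $x\in R$ and $n\ge 3$, $$\pi_{x,n}:=|\{(c_1,\ldots,c_n)\in R^n \mid \eta(c_1)\cdots\eta(c_n)=A \text{ and } c_2=x\}|.$$ For $a\in R$, $\nu_p(a)$ denotes the largest $k\in\{0,\ldots,r\}$ with $a\equiv 0 \pmod{p^k}$; in particular $\nu_p(0)=r$. For $x,u\in R$, $$\xi_{x,u}:=\begin{cases} p^{\nu_p(u)} & \text{if } \nu_p(u)\le\nu_p(x+1),\\ 0 & \text{if } \nu_p(u)>\nu_p(x+1),\end{cases}$$ $$\zeta_{x,u}:=\begin{cases} 0 & \text{if } x+u\in R^\times \text{ or } x\notin R^\times,\\ rp^r-(r-1)p^{r-1} & \text{if } x\in R^\times \text{ and } x+u=0,\\ (p^r-p^{r-1})\,\nu_p(x+u) & \text{if } x\in R^\times,\ \nu_p(x+u)>0 \text{ and } x+u\neq 0.\end{cases}$$ *)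

(* Defs.v *)
From mathcomp Require Import all_boot all_order all_algebra.

Set Implicit Arguments.
Unset Strict Implicit.
Unset Printing Implicit Defensive.

Import GRing.Theory.
Local Open Scope ring_scope.

Definition eta (R : nzRingType) (a : R) : 'M[R]_2 :=
  \matrix_(i, j) (if i == 0 then (if j == 0 then a else -1)
                  else (if j == 0 then 1 else 0)).

(* Entries are indexed from 0, so c_2 is the entry at position 1.  The default
   value of [nth] is only reached when [n < 2]. *)
Definition pi_count (R : finNzRingType) (A : 'M[R]_2) (x : R) (n : nat) : nat :=
  #|[set c : n.-tuple R |
      (\prod_(i < n) eta (tnth c i) == A) && (nth 0 c 1 == x)]|.

(* For [k <= r], [a = 0 mod p ^ k] does not depend on the representative of [a],
   so it is tested on the canonical one in [0, p ^ r). *)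
Definition nu (p r : nat) (a : 'Z_(p ^ r)) : nat :=
  \max_(k < r.+1 | (a : nat) == 0 %[mod p ^ k]) k.

Definition xi (p r : nat) (x u : 'Z_(p ^ r)) : nat :=
  if (nu u <= nu (x + 1)%R)%N then (p ^ nu u)%N else 0%N.

(* The subtractions on [nat] do not truncate when [0 < p] and [0 < r].  For
   [p] prime and [0 < r], the last branch is reached exactly when [x] is a unit,
   [0 < nu (x + u)] and [x + u != 0]. *)
Definition zeta (p r : nat) (x u : 'Z_(p ^ r)) : nat :=
  if (x + u \is a GRing.unit) || (x \isn't a GRing.unit) then 0%N
  else if x + u == 0 then (r * p ^ r - (r - 1) * p ^ (r - 1))%N
  else ((p ^ r - p ^ (r - 1)) * nu (x + u)%R)%N.

(* Main.v *)
Require Import Defs.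
From mathcomp Require Import all_boot all_order all_algebra.
From mathcomp Require Import ring zify.
Import GRing.Theory.
Local Open Scope ring_scope.

(** Fix [c_2 = u] and look at the next entry [c_3 = v].  A matrix [M] of
    determinant 1 whose top-left entry [d] is a unit can be brought to [eta d]
    by a lower unitriangular factor on the left and an upper unitriangular
    factor on the right, and these are absorbed by the neighbours, because
    [eta (a + s)] is [eta a] times a lower unitriangular matrix and
    [eta (b + t)] is an upper unitriangular matrix times [eta b].  Translating
    the two neighbours is a bijection, so the number of ways to complete
    [eta a * M * eta b * ...] to [A] depends on [M] only through [d]
    ([sandwich_unit]).

    If [u * v - 1] is a unit, this replaces the pair [(u, v)] by the single
    entry [x = u * v - 1], and the tuple loses one entry.  Otherwise the
    product [eta u * eta v * eta w] with the next entry [w = c_4] has top-left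
    entry [x = (u * v - 1) * w - u], which is a unit since [Z/p^r] is local,
    and the tuple loses two entries.  The recursion [pi_count_reduce] records
    this for any finite commutative ring with that local property.

    Grouping its two sums according to [x], the coefficients are the numbers of
    solutions [v] of [u * v = x + 1], and of solutions [(m, w)] with [m] a
    nonunit of [m * w = x + u], where [m = u * v - 1]; the latter substitution
    is bijective when [u] is a unit, and when [u] is not, no nonunit [m] occurs.
    The first number is [xi] ([xiE]): the solution set, if not empty, is a
    translate of the annihilator of [u], which consists of the [p ^ nu u]
    elements of valuation at least [r - nu u].  For the second, a nonunit [m]
    with [nu m = k <= nu (x + u)] contributes [p ^ k]; there are
    [p ^ (r - k) - p ^ (r - k - 1)] such [m] if [k < r], so every positive level
    [k <= nu (x + u)] below [r] contributes [p ^ r - p ^ (r - 1)], and the level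
    [k = r], present only when [x + u = 0], contributes [p ^ r].  The total is
    [zeta] ([zetaE]). *)

(** * Sums over tuples and over fibres *)

Lemma big_tuple_cons (T : finType) n (F : n.+1.-tuple T -> nat) :
  (\sum_t F t = \sum_a \sum_(t : n.-tuple T) F [tuple of a :: t])%N.
Proof.
rewrite pair_bigA /= (reindex (fun q : T * n.-tuple T => [tuple of q.1 :: q.2])) //.
exists (fun t : n.+1.-tuple T => (thead t, [tuple of behead t])) => [[a t] _ | t _] /=.
  by congr pair; apply: val_inj.
by rewrite -tuple_eta.
Qed.

Lemma sum_fiber (I J : finType) (P : pred I) (Q : pred J) (f : I -> J) (F : J -> nat) :
  (forall i, P i -> Q (f i)) ->
  (\sum_(i | P i) F (f i) = \sum_(j | Q j) F j * \sum_(i | P i) (f i == j))%N.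
Proof.
move=> PQ; rewrite (partition_big f Q) //=; apply: eq_bigr => j _.
rewrite big_distrr /= [LHS]big_mkcondr /=; apply: eq_bigr => i _.
by case: eqP => [->|_]; rewrite ?muln1 ?muln0.
Qed.

(** * Shortening a product of the matrices eta *)

Section Eta.

Variable R : finComUnitRingType.
Implicit Types (A M : 'M[R]_2) (a b u v w : R).

Lemma det_mx22 M : \det M = M 0 0 * M 1 1 - M 0 1 * M 1 0.
Proof.
rewrite (expand_det_row _ 0) !big_ord_recl big_ord0 /cofactor !det_mx11 !mxE /=.
rewrite (_ : lift 0 0 = 1); last exact: val_inj.
rewrite (_ : lift 1 0 = 0); last exact: val_inj.
by rewrite expr0 expr1 mul1r mulN1r mulrN addr0.
Qed.

Lemma det_eta a : \det (eta a) = 1.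
Proof. by rewrite det_mx22 !mxE /= mulr0 mulr1 sub0r opprK. Qed.

(** In a tuple [a :: u :: b :: t] counted by [pi_count], the factor [eta u] is
    generalized to an arbitrary matrix [M], so that the product of several
    consecutive factors can take its place. *)
Definition sandwich k A M : nat :=
  (\sum_a \sum_b \sum_(t : k.-tuple R)
    (eta a * M * eta b * \prod_(c <- t) eta c == A)%R)%N.

Lemma sandwich_cons k A M : sandwich k.+1 A M = (\sum_b sandwich k A (M * eta b))%N.
Proof.
rewrite /sandwich [RHS]exchange_big /=; apply: eq_bigr => a _; apply: eq_bigr => b _.
rewrite big_tuple_cons; apply: eq_bigr => c _; apply: eq_bigr => t _.
by rewrite big_cons !mulrA.
Qed.

Lemma pi_count_sandwich k A u : pi_count A u k.+3 = sandwich k A (eta u).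
Proof.
rewrite /pi_count -sum1dep_card big_mkcond /=.
under eq_bigr => c _ do rewrite -(big_tuple _ _ c predT (@eta R)).
rewrite big_tuple_cons; apply: eq_bigr => a _.
rewrite big_tuple_cons (bigD1 u) //= [X in (_ + X)%N]big1 ?addn0; last first.
  move=> x /negPf xu; apply: big1 => t _.
  by rewrite xu andbF.
rewrite big_tuple_cons; apply: eq_bigr => b _; apply: eq_bigr => t _.
by rewrite !big_cons eqxx andbT !mulrA; case: eqP.
Qed.

(** The hypotheses say that [M] is [eta w] multiplied on the left by the lower
    unitriangular matrix with entry [- s] and on the right by the upper
    unitriangular matrix with entry [t]. *)
Lemma eta_shift M w s t a b :
    M 0 0 = w -> M 0 1 = w * t - 1 -> M 1 0 = 1 - w * s ->
    M 1 1 = t + s - w * t * s ->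
  eta a * M * eta b = eta (a + s) * eta w * eta (b + t).
Proof.
move=> E00 E01 E10 E11.
have o1 : lift ord0 ord0 = 1 :> 'I_2 by apply: val_inj.
apply/matrixP=> i j.
rewrite -!mulmxE !mxE !big_ord_recl !big_ord0 /= !mxE !big_ord_recl !big_ord0 /= !mxE /=.
rewrite o1 E00 E01 E10 E11.
by case: (i == 0); case: (j == 0); ring.
Qed.

(** Since [w = M 0 0] is invertible, the off-diagonal entries of [M] determine
    the shifts [s] and [t] of [eta_shift], and [\det M = 1] forces [M 1 1]. The
    count is then preserved by the translations [a + s] and [b + t]. *)
Lemma sandwich_unit k A M : \det M = 1 -> M 0 0 \is a GRing.unit ->
  sandwich k A M = sandwich k A (eta (M 0 0)).
Proof.
rewrite det_mx22 => detM Uw; set w := M 0 0 in detM Uw *.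
set t := w^-1 * (M 0 1 + 1); set s := w^-1 * (1 - M 1 0).
have E01 : M 0 1 = w * t - 1 by rewrite mulVKr // addrK.
have E10 : M 1 0 = 1 - w * s by rewrite mulVKr // subKr.
have E11 : M 1 1 = t + s - w * t * s.
  apply: (mulrI Uw); rewrite E01 E10 in detM.
  by rewrite -[LHS](subrK ((w * t - 1) * (1 - w * s))) detM; ring.
rewrite /sandwich [RHS](reindex_inj (addIr s)) /=; apply: eq_bigr => a _.
rewrite [RHS](reindex_inj (addIr t)) /=; apply: eq_bigr => b _.
by apply: eq_bigr => c _; rewrite (eta_shift M w s t).
Qed.

Lemma eta2_00 u v : (eta u * eta v) 0 0 = u * v - 1.
Proof. by rewrite -mulmxE !mxE !big_ord_recl big_ord0 !mxE /=; ring. Qed.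

Lemma eta3_00 u v w : (eta u * eta v * eta w) 0 0 = (u * v - 1) * w - u.
Proof.
rewrite -!mulmxE !mxE !big_ord_recl big_ord0 !mxE /= !big_ord_recl !big_ord0 !mxE /=.
by ring.
Qed.

(** The hypothesis holds in every local ring: if [u * v - 1] is a nonunit, then
    [u] is a unit. *)
Lemma pi_count_reduce k A u :
  (forall v w, u * v - 1 \isn't a GRing.unit -> (u * v - 1) * w - u \is a GRing.unit) ->
  pi_count A u k.+3.+2 =
  (\sum_(v | (u * v - 1)%R \is a GRing.unit) pi_count A (u * v - 1)%R k.+4 +
   \sum_(v | (u * v - 1)%R \isn't a GRing.unit)
     \sum_w pi_count A ((u * v - 1) * w - u)%R k.+3)%N.
Proof.
move=> unit3; rewrite pi_count_sandwich sandwich_cons.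
rewrite (bigID (fun v => u * v - 1 \is a GRing.unit)) /=; congr addn.
  apply: eq_bigr => v Uv; rewrite pi_count_sandwich -eta2_00 sandwich_unit //.
    by rewrite -mulmxE det_mulmx !det_eta mulr1.
  by rewrite eta2_00.
apply: eq_bigr => v NUv; rewrite sandwich_cons; apply: eq_bigr => w _.
rewrite pi_count_sandwich -eta3_00 sandwich_unit //.
  by rewrite -!mulmxE !det_mulmx !det_eta !mulr1.
by rewrite eta3_00 unit3.
Qed.

End Eta.

(** * Valuations and linear equations modulo a prime power *)

Section Zpr.

Variables p r : nat.
Hypotheses (p_prime : prime p) (r_gt0 : (0 < r)%N).
Local Notation R := 'Z_(p ^ r).
Implicit Types (a b m u v x z : R) (j k : nat).

Lemma pr_gt1 : (1 < p ^ r)%N.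
Proof. by rewrite -(exp1n r) ltn_exp2r // prime_gt1. Qed.

Lemma nu_le a : (nu a <= r)%N.
Proof. by apply/bigmax_leqP => k _; rewrite -ltnS. Qed.

(** The exponents [k] with [p ^ k %| a] form an initial segment, which therefore
    ends at the maximum that defines [nu a]. *)
Lemma nuP a j : (j <= r)%N -> (j <= nu a)%N = (p ^ j %| a)%N.
Proof.
move=> jr; apply/idP/idP => [le_j | dv].
  have [k Pk E] : {k : 'I_r.+1 | (a : nat) == 0 %[mod p ^ k] & nu a = k}.
    rewrite /nu; apply: eq_bigmax_cond.
    by apply/card_gt0P; exists ord0; rewrite unfold_in expn0 !modn1.
  rewrite E in le_j; apply: dvdn_trans (dvdn_exp2l p le_j) _.
  by rewrite /dvdn (eqP Pk) mod0n.
have jr' : (j < r.+1)%N by [].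
apply: (@leq_bigmax_cond _ _ (fun k : 'I_r.+1 => k : nat) (Ordinal jr')).
by rewrite mod0n.
Qed.

Lemma dvd_nu a : (p ^ nu a %| a)%N.
Proof. by rewrite -nuP ?nu_le. Qed.

Lemma val_dvdM a b j : (j <= r)%N -> (p ^ j %| (a * b)%R)%N = (p ^ j %| a * b)%N.
Proof.
move=> jr; rewrite -[a in LHS]natr_Zp -[b in LHS]natr_Zp -natrM val_Zp_nat ?pr_gt1 //.
by rewrite /dvdn modn_dvdm // dvdn_exp2l.
Qed.

Lemma val_dvdD a b j : (j <= r)%N -> (p ^ j %| (a + b)%R)%N = (p ^ j %| a + b)%N.
Proof.
move=> jr; rewrite -[a in LHS]natr_Zp -[b in LHS]natr_Zp -natrD val_Zp_nat ?pr_gt1 //.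
by rewrite /dvdn modn_dvdm // dvdn_exp2l.
Qed.

Lemma ltn_Zpr a : (a < p ^ r)%N.
Proof. by have := ltn_ord a; rewrite [X in (_ < X)%N]Zp_cast ?pr_gt1. Qed.

Lemma Zpr_gt0 a : (0 < a)%N = (a != 0).
Proof. by rewrite lt0n. Qed.

Lemma nu0 : nu (0 : R) = r.
Proof. by apply/eqP; rewrite eqn_leq nu_le nuP //=; apply: dvdn0. Qed.

Lemma nu_eq_r a : (nu a == r) = (a == 0).
Proof.
rewrite eqn_leq nu_le nuP //=; apply/idP/eqP => [dv | ->]; last exact: dvdn0.
apply: val_inj => /=; apply/eqP; apply: contraLR dv; rewrite -lt0n => a0.
by rewrite gtnNdvd // ltn_Zpr.
Qed.

Lemma nonunit_dvd a : (a \isn't a GRing.unit) = (p %| a)%N.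
Proof.
rewrite -[a in LHS]natr_Zp unitZpE ?pr_gt1 // coprime_pexpl // prime_coprime //.
by rewrite negbK.
Qed.

Lemma nonunit_nu a : (a \isn't a GRing.unit) = (0 < nu a)%N.
Proof. by rewrite nonunit_dvd nuP // expn1. Qed.

Lemma nonunitMr a b : a \isn't a GRing.unit -> a * b \isn't a GRing.unit.
Proof. by rewrite unitrM negb_and => ->. Qed.

Lemma nonunitD a b : a \isn't a GRing.unit -> b \isn't a GRing.unit ->
  a + b \isn't a GRing.unit.
Proof.
rewrite !nonunit_dvd => pa pb.
by have := val_dvdD a b 1 r_gt0; rewrite expn1 => ->; rewrite dvdn_add.
Qed.

Lemma nonunit_addr a b : a \isn't a GRing.unit -> b \is a GRing.unit ->
  a + b \is a GRing.unit.
Proof.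
move=> Na; apply: contraLR => Nab.
by rewrite -[b](addKr a) nonunitD ?unitrN.
Qed.

(** By locality: [u] divides the unit [1 + (u * v - 1)], so it is a unit, and it
    is only changed by the nonunit multiple [(u * v - 1) * w]. *)
Lemma nonunit_minor_unit u v w : u * v - 1 \isn't a GRing.unit ->
  (u * v - 1) * w - u \is a GRing.unit.
Proof.
move=> Nuv; apply: nonunit_addr; first exact: nonunitMr.
rewrite unitrN; apply: contraR Nuv => Nu.
by rewrite nonunit_addr ?nonunitMr // unitrN unitr1.
Qed.

Lemma card_nu_ge j : (j <= r)%N -> (\sum_(a : R) (j <= nu a) = p ^ (r - j))%N.
Proof.
move=> jr; under eq_bigr => a _ do rewrite nuP //.
rewrite -(big_mkord predT (fun i => (p ^ j %| i)%N : nat)) Zp_cast ?pr_gt1 //.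
have pr_gt0 := ltnW pr_gt1.
(* [divn_count_dvd] counts the multiples in [1, p ^ r], so the end point [p ^ r]
   is traded for [0]; both are multiples of [p ^ j]. *)
apply: (@addIn (p ^ j %| p ^ r)%N); rewrite -big_nat_recr //= big_ltn // dvdn0.
rewrite -divn_count_dvd dvdn_exp2l // [LHS]addnC; congr addn.
by rewrite expnB ?prime_gt0.
Qed.

Lemma nu_logn a : a != 0 -> nu a = logn p a.
Proof.
move=> a_neq0; have a_gt0 : (0 < a)%N by rewrite Zpr_gt0.
have nua : (nu a < r)%N by rewrite ltn_neqAle nu_eq_r a_neq0 nu_le.
apply/eqP; rewrite eqn_leq -pfactor_dvdn // -nuP ?nu_le // leqnn /=.
by rewrite leqNgt -pfactor_dvdn // -nuP // ltnn.
Qed.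

(** [nu] is not additive on products, being capped at [r]; additivity survives
    in the form of this criterion for the product to vanish. *)
Lemma mulr_eq0_nu a b : (a * b == 0) = (r <= nu a + nu b)%N.
Proof.
have [-> | a0] := eqVneq a 0.
  by rewrite nu0 mul0r eqxx leq_addr.
have [-> | b0] := eqVneq b 0.
  by rewrite nu0 mulr0 eqxx leq_addl.
rewrite -nu_eq_r eqn_leq nu_le nuP //= val_dvdM // !nu_logn //.
by rewrite -lognM ?Zpr_gt0 // pfactor_dvdn // muln_gt0 !Zpr_gt0 a0.
Qed.

Lemma nu_leM a b : (nu a <= nu (a * b)%R)%N.
Proof. by rewrite nuP ?nu_le // val_dvdM ?nu_le // dvdn_mulr // dvd_nu. Qed.

Lemma nu_dvdr a z : (nu a <= nu z)%N -> exists v, a * v = z.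
Proof.
have [-> | a0] := eqVneq a 0.
  rewrite nu0 => rz; exists 0; apply/eqP; rewrite mul0r eq_sym -nu_eq_r eqn_leq nu_le.
  exact: rz.
rewrite nuP ?nu_le // nu_logn // => /dvdnP[q zE].
have a_gt0 : (0 < a)%N by rewrite Zpr_gt0.
have [m cop aE] := pfactor_coprime p_prime a_gt0.
have Um : (m%:R : R) \is a GRing.unit by rewrite unitZpE ?pr_gt1 // coprime_pexpl.
exists (q%:R / m%:R); rewrite -[a]natr_Zp -[z]natr_Zp aE zE !natrM.
by rewrite mulrAC [X in X * _]mulrC divrK.
Qed.

(** A solution [v0] translates the equation to [u * v = 0], that is
    [r - nu u <= nu v]. *)
Lemma card_mulr_eq u z :
  (\sum_v (u * v == z)%R = if nu u <= nu z then p ^ nu u else 0)%N.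
Proof.
case: ifP => [le_uz | nle_uz]; last first.
  rewrite big1 // => v _; case: eqP nle_uz => // <-.
  by rewrite nu_leM.
have [v0 <-] := nu_dvdr _ _ le_uz.
rewrite (reindex_inj (addIr v0)) /= -[nu u in RHS](subKn (nu_le u)).
rewrite -card_nu_ge ?leq_subr //.
apply: eq_bigr => v _.
by rewrite mulrDr -subr_eq0 addrK mulr_eq0_nu leq_subLR.
Qed.

(** Each valuation level below [r] carries the same total weight, as the weight
    [p ^ j] cancels the index [p ^ j] of the ideal generated by [p ^ j]. *)
Lemma sum_nu_eq j : (j < r)%N ->
  (\sum_(a : R) p ^ nu a * (nu a == j) = p ^ r - p ^ (r - 1))%N.
Proof.
move=> jr; transitivity (p ^ j * \sum_(a : R) (nu a == j))%N.
  by rewrite big_distrr /=; apply: eq_bigr => a _; case: eqP => [->|]; rewrite ?muln0.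
have <- : (\sum_(a : R) (j <= nu a) - \sum_(a : R) (j.+1 <= nu a) =
            \sum_(a : R) (nu a == j))%N.
  rewrite -sumnB => [|a _]; last by case: ltngtP.
  by apply: eq_bigr => a _; case: ltngtP.
rewrite !card_nu_ge //; last exact: ltnW.
rewrite mulnBr -!expnD subnKC; last exact: ltnW.
by congr (_ - p ^ _)%N; lia.
Qed.

Lemma sum_nu_le l : (l < r)%N ->
  (\sum_(a : R) p ^ nu a * (0 < nu a <= l) = (p ^ r - p ^ (r - 1)) * l)%N.
Proof.
elim: l => [|l IHl] lr.
  by rewrite muln0 big1 // => a _; case: (nu a) => [|?] /=; rewrite muln0.
rewrite mulnS -{1}(sum_nu_eq l.+1) // -IHl 1?ltnW // -big_split /=.
apply: eq_bigr => a _; rewrite -mulnDr; congr muln.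
by case: (nu a) => [|k] //=; rewrite eqSS; lia.
Qed.

(** The levels [1], ..., [r - 1] have equal weight and the level [r] consists of
    [0] alone. *)
Lemma sum_nu_gt0 :
  (\sum_(a : R) p ^ nu a * (0 < nu a) = r * p ^ r - (r - 1) * p ^ (r - 1))%N.
Proof.
rewrite (bigD1 0) //= nu0 r_gt0 muln1.
transitivity (p ^ r + (p ^ r - p ^ (r - 1)) * r.-1)%N; last first.
  have : (p ^ (r - 1) <= p ^ r)%N by rewrite leq_exp2l ?prime_gt1 // leq_subr.
  case: r r_gt0 => // s _; rewrite subn1 /= => le.
  by rewrite mulnBl mulSn [(s * _)%N]mulnC [(s * _)%N]mulnC addnBA // leq_mul2r le orbT.
congr addn; rewrite -sum_nu_le; last by case: r r_gt0.
rewrite [RHS](bigD1 0) //= nu0 (_ : (r <= r.-1)%N = false); last first.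
  by case: r r_gt0 => // s _; rewrite ltnn.
rewrite andbF muln0 add0n.
apply: eq_bigr => a a0.
have ->: (nu a <= r.-1)%N by rewrite -ltnS prednK // ltn_neqAle nu_eq_r a0 nu_le.
by rewrite andbT.
Qed.

(** For fixed [m] there are [p ^ nu m] or no solutions [w], according to whether
    [nu m <= nu z]; so [p ^ nu m] is summed over [0 < nu m <= nu z]. *)
Lemma card_nonunit_mulr_eq z :
  (\sum_(m : R | m \isn't a GRing.unit) \sum_w (m * w == z)%R =
   if z == 0%R then r * p ^ r - (r - 1) * p ^ (r - 1)
   else (p ^ r - p ^ (r - 1)) * nu z)%N.
Proof.
transitivity (\sum_(a : R) p ^ nu a * (0 < nu a <= nu z))%N.
  rewrite big_mkcond; apply: eq_bigr => m _; rewrite nonunit_nu card_mulr_eq.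
  by case: (0 < nu m)%N; case: (nu m <= nu z)%N; rewrite /= ?muln0 ?muln1.
have [-> | z0] := eqVneq z 0; last first.
  by rewrite sum_nu_le // ltn_neqAle nu_eq_r z0 nu_le.
by rewrite nu0 -sum_nu_gt0; apply: eq_bigr => a _; rewrite nu_le andbT.
Qed.

(** If [u] is a unit, [v |-> u * v - 1] is a bijection and [card_nonunit_mulr_eq]
    applies. If not, the sum over [v] is empty, and [x + u] is a unit. *)
Lemma zetaE x u : x \is a GRing.unit ->
  zeta x u = (\sum_(v | (u * v - 1)%R \isn't a GRing.unit)
                \sum_w ((u * v - 1) * w - u == x)%R)%N.
Proof.
move=> Ux; rewrite /zeta Ux orbF.
have [Uu | Nu] := boolP (u \is a GRing.unit); last first.
  rewrite [x + u]addrC nonunit_addr // big_pred0 // => v.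
  by rewrite nonunit_addr ?nonunitMr // unitrN unitr1.
transitivity (\sum_(m : R | m \isn't a GRing.unit)
                \sum_w (m * w == x + u)%R)%N; last first.
  rewrite (reindex (fun v => u * v - 1)) /=.
    by apply: eq_bigr => v _; apply: eq_bigr => w _; rewrite subr_eq.
  exists (fun m => u^-1 * (m + 1)) => [v|m] _; first by rewrite subrK mulKr.
  by rewrite mulVKr // addrK.
rewrite card_nonunit_mulr_eq; case: ifP => // Uxu; case: eqP => [E|_].
  by rewrite E unitr0 in Uxu.
have := nonunit_nu (x + u); rewrite Uxu /= => /esym/negbT.
by rewrite -eqn0Ngt => /eqP ->; rewrite muln0.
Qed.

Lemma xiE x u : xi x u = (\sum_v (u * v - 1 == x)%R)%N.
Proof. by rewrite /xi -card_mulr_eq; apply: eq_bigr => v _; rewrite subr_eq. Qed.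

End Zpr.

(** * The recursion *)

Theorem proposition5p2 (p r : nat) (hp : prime p) (hr : (1 <= r)%N)
    (A : 'M['Z_(p ^ r)]_2) (u : 'Z_(p ^ r)) (n : nat) (hn : (5 <= n)%N) :
  pi_count A u n =
    (\sum_(x : 'Z_(p ^ r) | x \is a GRing.unit)
       (pi_count A x (n - 1) * xi x u + pi_count A x (n - 2) * zeta x u))%N.
Proof.
case: n hn => [|[|[|[|[|k]]]]] // _; rewrite !subSS !subn0.
rewrite pi_count_reduce.
  rewrite big_split /=; congr addn.
    rewrite (sum_fiber _ _ _ (fun x => x \is a GRing.unit) _
      (fun x => pi_count A x k.+4)) //.
    apply: eq_bigr => x Ux; congr muln; rewrite xiE // big_mkcond /=.
    by apply: eq_bigr => v _; case: ifPn => //; case: eqP => // ->; rewrite Ux.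
  rewrite pair_big_dep /=.
  rewrite (sum_fiber _ _ _ (fun x => x \is a GRing.unit)
    (fun q : 'Z_(p ^ r) * 'Z_(p ^ r) => (u * q.1 - 1) * q.2 - u)
    (fun x => pi_count A x k.+3)).
    by apply: eq_bigr => x Ux; rewrite (zetaE _ _ hp hr) // pair_big_dep.
  by case=> v w /andP[Nuv _]; exact: nonunit_minor_unit.
exact: nonunit_minor_unit.
Qed.
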